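(* Let $a\in(-1,1)$ and let $H$ be the operator in $L^2((-\frac{\pi}{2},\frac{\pi}{2}))$ defined by $H\psi=-\psi''$ on the domain $\mathsf{D}(H)=\{\psi\in H^2((-\frac{\pi}{2},\frac{\pi}{2})) : \psi(-\frac{\pi}{2})=\psi(\frac{\pi}{2}a)=\psi(\frac{\pi}{2})\}$. The eigenfunctions of $H$ together with the generalised eigenfunctions form a complete set in $L^2((-\frac{\pi}{2},\frac{\pi}{2}))$, i.e. their linear span is dense in $L^2((-\frac{\pi}{2},\frac{\pi}{2}))$.
   Context: $L^2((-\frac{\pi}{2},\frac{\pi}{2}))$ is the complex Hilbert space of square-integrable functions and $H^2$ denotes the usual Sobolev space, whose elements are identified with their continuous representatives on $[-\frac{\pi}{2},\frac{\pi}{2}]$. The eigenfunctions and generalised eigenfunctions of $H$ associated with an eigenvalue $\lambda$ are the non-zero elements of $\bigcup_{n\ge1}\ker(H-\lambda)^n$. *)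

(* Defs.v *)
(* MathComp-Analysis, over an arbitrary [R : realType]; complex numbers are
   [R[i]] from mathcomp-real-closed. *)
From HB Require Import structures.
From mathcomp Require Import all_boot all_order all_algebra.
From mathcomp Require Import complex.
From mathcomp Require Import all_classical all_reals all_analysis.

Set Implicit Arguments.
Unset Strict Implicit.
Unset Printing Implicit Defensive.

Import Order.TTheory GRing.Theory Num.Theory.
Import numFieldNormedType.Exports.

Local Open Scope classical_set_scope.
Local Open Scope ring_scope.
Local Open Scope complex_scope.

Section ComplexL2.
Context {R : realType}.
Implicit Types (D : set R) (f g h : R -> R[i]).

Local Notation mu := (@lebesgue_measure R).

(* An element of L^2(D) is represented by a function [R -> R[i]] that is
   Lebesgue square-integrable on [D]; two representatives denote the same
   element iff they are a.e. equal on [D], and values outside [D] are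
   irrelevant. *)
Definition L2norm D f : \bar R :=
  ('N[mu]_2[(fun x => (Normc.normc (f x))%:E) \_ D])%E.

Definition L2 D f : Prop :=
  [/\ measurable_fun D (fun x => complex.Re (f x)),
      measurable_fun D (fun x => complex.Im (f x)) &
      (L2norm D f < +oo)%E].

Definition L2_eq D f g : Prop := f = g %[ae mu in D].

Definition cintegral D f : R[i] :=
  (\int[mu]_(x in D) complex.Re (f x)) +i*
  (\int[mu]_(x in D) complex.Im (f x)).

Definition test_function D (phi : R -> R) : Prop :=
  (forall n x, derivable (derive1n n phi) x 1) /\
  compactly_in D (closure [set x | phi x != 0]).

Definition weak_derivative D (k : nat) f g : Prop :=
  forall phi, test_function D phi ->
    cintegral D (fun x => f x * (derive1n k phi x)%:C) =
    (-1) ^+ k * cintegral D (fun x => g x * (phi x)%:C).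

(* The Sobolev space H^m(D) = W^{m,2}(D). *)
Definition sobolevH D (m : nat) f : Prop :=
  L2 D f /\
  forall k, (1 <= k <= m)%N -> exists2 g, L2 D g & weak_derivative D k f g.

(* An unbounded operator in L^2(D) is given by its graph, a relation between
   representatives that respects [L2_eq] on [L2 D]. *)
Definition operator := (R -> R[i]) -> (R -> R[i]) -> Prop.

Implicit Type T : operator.

Definition op_sub T (l : R[i]) : operator := fun f g =>
  exists2 h, T f h & g = (fun x => h x - l * f x).

(* T^n, with D(T^{n+1}) = {f in D(T) : T f in D(T^n)}. *)
Fixpoint op_pow D T (n : nat) : operator :=
  if n is m.+1 then fun f g => exists2 h, T f h & op_pow D T m h g
  else fun f g => [/\ L2 D f, L2 D g & L2_eq D f g].

Definition op_ker T : set (R -> R[i]) := [set f | T f (cst 0)].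

Definition eigenvalue_of D T (l : R[i]) : Prop :=
  exists2 f, op_ker (op_sub T l) f & ~ L2_eq D f (cst 0).

Definition generalised_eigenfunctions D T : set (R -> R[i]) :=
  [set f | ~ L2_eq D f (cst 0) /\
     exists2 l, eigenvalue_of D T l &
       exists2 n, (1 <= n)%N & op_ker (op_pow D (op_sub T l) n) f].

Definition lin_span (S : set (R -> R[i])) : set (R -> R[i]) :=
  [set g | exists n (c : 'I_n -> R[i]) (u : 'I_n -> R -> R[i]),
     (forall i, S (u i)) /\ g = (fun x => \sum_(i < n) c i * u i x)].

Definition dense_in_L2 D (S : set (R -> R[i])) : Prop :=
  S `<=` L2 D /\
  forall f, L2 D f -> forall e : R, 0 < e ->
    exists2 g, S g & (L2norm D (fun x => f x - g x)%R < e%:E)%E.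

End ComplexL2.

Section OperatorH.
Context {R : realType}.
Implicit Types (f g psi : R -> R[i]).

Definition itvpi : set R := `]- (pi / 2), pi / 2[.

(* Continuity on the closed interval, stated through real and imaginary
   parts. *)
Definition continuous_on_closure psi : Prop :=
  {within `[- (pi / 2), pi / 2], continuous (fun x => complex.Re (psi x))} /\
  {within `[- (pi / 2), pi / 2], continuous (fun x => complex.Im (psi x))}.

(* Boundary values are those of the continuous representative [psi] of [f]. *)
Definition domH (a : R) f : Prop :=
  sobolevH itvpi 2 f /\
  exists psi, [/\ L2_eq itvpi f psi, continuous_on_closure psi,
    psi (- (pi / 2)) = psi (pi / 2 * a) &
    psi (pi / 2 * a) = psi (pi / 2)].

Definition opH (a : R) : operator := fun f g =>
  [/\ domH a f, L2 itvpi g & weak_derivative itvpi 2 f (fun x => - g x)].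

End OperatorH.

(* Main.v *)
(* Put b, c = (1 + |a|) pi / 4, (1 - |a|) pi / 4, so that b + c = pi / 2 and
   c <= b. Root functions of H are cos(n pi x / b), cos(n pi x / c), for each
   m >= 1 some A cos(2 m x) + sin(2 m x), and x sin(k x) for every common
   frequency k = n pi / c in (pi / b) N. The closed span W of the root functions
   is stable under bounded pointwise limits; hence, by a monotone class
   argument, m th^n in W for all n implies m psi(th) in W for bounded measurable
   m psi(th).
   With m = 1 and th = cos(pi x / b) this puts in W every f o fold, where
   fold x = |x| if |x| <= b, 2 b - |x| otherwise. For an even root
   function r of frequency n pi / c, r - r o fold is a multiple of
   H_n = 1_{|x| > b} sin(n pi (|x| - b) / c); the factor is -2 sin(n pi b / c) for
   r = cos(n pi x / c), and when it vanishes the generalised eigenfunction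
   r = x sin(n pi x / c) gives the factor +-2 b. So H_n in W for all n >= 1, and
   m = H_1, th = cos(pi (|x| - b) / c) yields f - f o fold for every bounded even
   f. Thus all even functions are in W, hence also all sin(2 m x), and
   m = sin(2 x), th = cos(2 x) yields the odd functions. *)
Require Import Defs.
From mathcomp Require Import all_boot all_order all_algebra.
From mathcomp Require Import complex.
From mathcomp Require Import all_classical all_reals all_analysis.
From mathcomp Require Import measurable_realfun.
From mathcomp Require Import ring lra.

Set Implicit Arguments.
Unset Strict Implicit.
Unset Printing Implicit Defensive.

Import Order.TTheory GRing.Theory Num.Theory.
Import numFieldNormedType.Exports.

Local Open Scope classical_set_scope.
Local Open Scope ring_scope.

(** * Functional monotone classes *)

Section thresholds.
Context {R : realType}.
Implicit Types x y t : R.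

Lemma bernoulli_ineq t n : -1 <= t -> 1 + n%:R * t <= (1 + t) ^+ n.
Proof.
move=> t1; elim: n => [|n IH]; first by rewrite mul0r addr0 expr0.
have h : 0 <= 1 + t by lra.
rewrite exprSr; apply: le_trans (ler_wpM2r h IH).
have : 0 <= n%:R * t ^+ 2 by rewrite mulr_ge0 // sqr_ge0.
by rewrite -natr1; lra.
Qed.

Lemma expr_onem_le t n : 0 <= t <= 1 -> (1 - t) ^+ n <= (1 + n%:R * t)^-1.
Proof.
move=> /andP[t0 t1].
have p : 0 < 1 + n%:R * t by rewrite ltr_pwDl // mulr_ge0.
rewrite -[leRHS]mul1r ler_pdivlMr //.
apply: (@le_trans _ _ ((1 - t) ^+ n * (1 + t) ^+ n)).
  by rewrite ler_wpM2l ?exprn_ge0 ?bernoulli_ineq //; lra.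
by rewrite -exprMn exprn_ile1 //; nra.
Qed.

(** With [z] the square root of [y], [n y^n = (n z^n) z^n]: the first factor is bounded, by
    Bernoulli at [1/z], and the second tends to 0. *)
Lemma cvg_nat_mul_expr y : 0 <= y < 1 -> n%:R * y ^+ n @[n --> \oo] --> (0 : R).
Proof.
move=> /andP[y0 y1]; have [->|yn0] := eqVneq y 0.
  apply: cvg_near_cst; near=> n; rewrite expr0n gtn_eqF ?mulr0 //.
  by near: n; exists 1%N.
set z := Num.sqrt y.
have z0 : 0 < z by rewrite sqrtr_gt0 lt_neqAle eq_sym yn0.
have zy : z ^+ 2 = y by rewrite sqr_sqrtr.
have z1 : z < 1 by rewrite -(@ltr_pXn2r _ 2) ?nnegrE ?zy ?expr1n ?ltW.
have d0 : 0 < z^-1 - 1 by rewrite subr_gt0 invf_gt1.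
have nz n : n%:R * z ^+ n <= (z^-1 - 1)^-1.
  rewrite -[leRHS]mul1r ler_pdivlMr // mulrAC.
  have h : n%:R * (z^-1 - 1) <= z^-1 ^+ n.
    have := @bernoulli_ineq (z^-1 - 1) n _.
    rewrite (_ : 1 + (z^-1 - 1) = z^-1); last by lra.
    lra.
  apply: (le_trans (ler_wpM2r _ h)); first exact: exprn_ge0 (ltW z0).
  by rewrite -exprMn mulVf ?gt_eqF // expr1n.
apply: (@squeeze_cvgr _ _ _ _ (cst 0) (geometric (z^-1 - 1)^-1 z)).
- near=> n; rewrite mulr_ge0 ?exprn_ge0 //= -zy -exprM mulnC exprM expr2 -exprMn.
  rewrite exprMn mulrA ler_wpM2r // exprn_ge0 // ltW //.
- exact: cvg_cst.
- by apply: cvg_geometric; rewrite ger0_norm // ltW.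
Unshelve. all: by end_near. Qed.

(* The exponent n * 2^n, rather than 2^n, makes the limit vanish at 1/2 too. *)
Definition threshold (n : nat) x := (1 - x ^+ n) ^+ (n * 2 ^ n).

Lemma threshold_itv (n : nat) x : 0 <= x <= 1 -> 0 <= threshold n x <= 1.
Proof.
move=> /andP[x0 x1]; have y0 : 0 <= x ^+ n by rewrite exprn_ge0.
have y1 : x ^+ n <= 1 by rewrite exprn_ile1.
by rewrite exprn_ge0 ?exprn_ile1 //; lra.
Qed.

(** Below [1/2], Bernoulli gives the lower bound [1 - n (2 x)^n]; from [1/2] on, [(2 x)^n >= 1] and
    [expr_onem_le] give the upper bound [1 / (1 + n)]. *)
Lemma threshold_cvg x : 0 <= x <= 1 ->
  threshold n x @[n --> \oo] --> ((x < 2^-1)%R%:R : R).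
Proof.
move=> x01; have /andP[x0 x1] := x01; case: ltP => xh /=.
  apply: (@squeeze_cvgr _ _ _ _ (fun n => 1 - n%:R * (2 * x) ^+ n) (cst 1)).
  - near=> n; have /andP[_ ->] := threshold_itv n x01.
    rewrite andbT; have y1 : x ^+ n <= 1 by rewrite exprn_ile1.
    have := @bernoulli_ineq (- x ^+ n) (n * 2 ^ n) _.
    rewrite /threshold natrM natrX exprMn; lra.
  - rewrite -[X in _ --> X]subr0; apply: cvgB; first exact: cvg_cst.
    by apply: cvg_nat_mul_expr; lra.
  - exact: cvg_cst.
apply: (@squeeze_cvgr _ _ _ _ (cst 0) (@harmonic R)).
- near=> n; have /andP[-> _] /= := threshold_itv n x01.
  have y0 : 0 <= x ^+ n by rewrite exprn_ge0.
  have y1 : x ^+ n <= 1 by rewrite exprn_ile1.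
  apply: (le_trans (@expr_onem_le _ _ _)); first by rewrite y0.
  have h : 1 <= (2 * x) ^+ n by rewrite exprn_ege1 //; lra.
  have : n%:R * 1 <= n%:R * (2 * x) ^+ n by rewrite ler_wpM2l.
  rewrite mulr1 exprMn mulrA natrM natrX => h2.
  have n0 := ler0n R n.
  have h3 : n.+1%:R <= 1 + n%:R * 2 ^+ n * x ^+ n by rewrite -natr1; lra.
  by rewrite lef_pV2 ?posrE //; apply: lt_le_trans h3; rewrite ltr0n.
- exact: cvg_cst.
- exact: cvg_harmonic.
Unshelve. all: by end_near. Qed.

End thresholds.

(** * The monotone class argument *)

Section closed_class.
Import HBNNSimple.
Context {R : realType}.
Implicit Types (D A : set R) (W : set (R -> R)) (m th psi f g : R -> R).

Record closed_class D W : Prop := ClosedClass {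
  closed_classD : forall f g, W f -> W g -> W (fun x => f x + g x);
  closed_classZ : forall (c : R) f, W f -> W (fun x => c * f x);
  closed_classL : forall (f_ : nat -> R -> R) f (K : R), (forall n, W (f_ n)) ->
    (forall n x, D x -> `|f_ n x| <= K) ->
    (forall x, D x -> f_ n x @[n --> \oo] --> f x) -> W f }.

Variables (D : set R) (W : set (R -> R)) (cW : closed_class D W).

Lemma closed_class_sum (I : Type) (s : seq I) (F : I -> R -> R) :
  W (cst 0) -> (forall i, W (F i)) -> W (fun x => \sum_(i <- s) F i x).
Proof.
move=> W0 WF; elim: s => [|i s IH].
  by rewrite (_ : (fun _ => _) = cst 0) //; apply/funext => x; rewrite big_nil.
rewrite (_ : (fun _ => _) = (fun x => F i x + \sum_(i <- s) F i x)).
  exact: (closed_classD cW).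
by apply/funext => x; rewrite big_cons.
Qed.

Lemma closed_class0 f : W f -> W (cst 0).
Proof.
move=> /(closed_classZ cW 0); congr W.
by apply/funext => x; rewrite mul0r.
Qed.

Lemma closed_classB f g : W f -> W g -> W (fun x => f x - g x).
Proof.
move=> Wf /(closed_classZ cW (-1)) /(closed_classD cW Wf); congr W.
by apply/funext => x; rewrite mulN1r.
Qed.

Variables (m th : R -> R) (K : R).
Hypothesis mK : forall x, D x -> `|m x| <= K.
Hypothesis th1 : forall x, D x -> `|th x| <= 1.
Hypothesis Wm : forall n, W (fun x => m x * th x ^+ n).

Let W0 : W (cst 0) := closed_class0 (Wm 0).

Let Wpoly (p : {poly R}) : W (fun x => m x * p.[th x]).
Proof.
rewrite (_ : (fun _ => _) =
    (fun x => \sum_(i < size p) p`_i * (m x * th x ^+ i))).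
  by apply: closed_class_sum => // i; exact: (closed_classZ cW).
apply/funext => x; rewrite horner_coef mulr_sumr.
by apply: eq_bigr => i _; rewrite mulrCA.
Qed.

(** The indicator is the pointwise limit of [threshold n] taken at an affine function of [th], and
    each of these is a polynomial in [th]. *)
Let Wlt (c : R) : W (fun x => m x * \1_(`]-oo, c[) (th x)).
Proof.
(* The affine [q] sends [c] to [1/2], and [k] is large enough for [q] to map [[-1, 1]] into
   [[0, 1]]. *)
pose k := 2 * (1 + `|c|).
have k0 : 0 < k by rewrite mulr_gt0 // ltr_pwDl.
pose q : {poly R} := (2^-1 - c / k)%:P + k^-1 *: 'X.
have qE y : q.[y] = 2^-1 + (y - c) / k by rewrite !hornerE; lra.
have q01 x : D x -> 0 <= q.[th x] <= 1.
  move=> /th1; rewrite qE ler_norml => /andP[t1 t2].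
  have : `|th x - c| / k <= 2^-1.
    rewrite ler_pdivrMr // /k mulrA mulVf // mul1r.
    by rewrite (le_trans (ler_normB _ _)) // lerD2r ler_norml t1.
  rewrite -(gtr0_norm k0) -normf_div ler_norml (gtr0_norm k0) => /andP[]; lra.
apply: (closed_classL cW (f_ := fun n x => m x * threshold n q.[th x]) (K := K)).
- move=> n; have := Wpoly ((1 - q ^+ n) ^+ (n * 2 ^ n)).
  by congr W; apply/funext => x; rewrite /threshold !(horner_exp, hornerE).
- move=> n x Dx; have /andP[u0 u1] := threshold_itv n (q01 x Dx).
  rewrite normrM (ger0_norm u0) (le_trans _ (mK Dx)) //.
  by rewrite ler_piMr.
- move=> x Dx; apply: cvgM; first exact: cvg_cst.
  rewrite (_ : \1_ _ _ = (q.[th x] < 2^-1)%R%:R); first exact/threshold_cvg/q01.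
  rewrite indicE mem_setE in_itv /= qE gtrDl.
  by rewrite pmulr_llt0 ?invr_gt0 // subr_lt0.
Qed.

(** The sets [A] with this property form a lambda-system. It contains the open half-lines []-oo,
    c[], a pi-system that generates the Borel sets. *)
Let Windic A : measurable A -> W (fun x => m x * \1_A (th x)).
Proof.
move=> mA.
suff : <<s @RGenInftyO.G R >> `<=`
    [set A | W (fun x => m x * \1_A (th x))].
  by apply; move: mA; rewrite
    -[<<s _>> _]/((@RGenInftyO.G R).-sigma.-measurable A) -RGenInftyO.measurableE.
apply: lambda_system_subset => //.
- move=> _ _ [x ->] [y ->]; exists (Num.min x y).
  by apply/seteqP; split => z /=; rewrite !in_itv /= lt_min => /andP.
- split => //.
  + rewrite /=; have := Wm 0; congr W; apply/funext => x.
    by rewrite indicT expr0.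
  + move=> A1 A2 A21 /= W1 W2; have := closed_classB W1 W2; congr W.
    apply/funext => x; rewrite -mulrBr; congr (_ * _).
    rewrite !indicE in_setD; have [xA2|] := boolP (th x \in A2).
      by rewrite (_ : th x \in A1) ?subrr // mem_set //; apply/A21/set_mem.
    by rewrite subr0 andbT.
  + move=> F ndF WF /=.
    apply: (closed_classL cW (K := K) WF).
    * move=> n x Dx; rewrite normrM (le_trans _ (mK Dx)) //.
      by rewrite ler_piMr // indicE; case: (_ \in _); rewrite ?normr1 ?normr0.
    * move=> x Dx; apply: cvgM; first exact: cvg_cst.
      apply: cvg_near_cst.
      have [[i _ Fi]|nF] := pselect ((\bigcup_i F i) (th x)).
        near=> n; rewrite !indicE !mem_set //; first by exists i.
        by have : (F i <= F n)%O by [apply: ndF; near: n; exists i];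
           rewrite subsetEset; apply.
      near=> n; rewrite !indicE !memNset // => Fn; apply: nF.
      by exists n.
- by move=> _ [c ->] /=; exact: Wlt.
Unshelve. all: by end_near. Qed.

(** Simple functions increasing to [psi] are finite combinations of indicators, and their products
    with [m] inherit the bound [K']. *)
Let Wge0 psi (K' : R) : measurable_fun setT psi -> (forall y, 0 <= psi y) ->
  (forall x, D x -> `|m x * psi (th x)| <= K') ->
  W (fun x => m x * psi (th x)).
Proof.
move=> mpsi psi0 mK'.
have mE : measurable_fun setT (EFin \o psi) by exact/measurable_EFinP.
have psiE0 y : setT y -> (0 <= (EFin \o psi) y)%E by rewrite lee_fin.
pose g n := nnsfun_approx measurableT mE n.
apply: (closed_classL cW (f_ := fun n x => m x * g n (th x)) (K := K')).
- move=> n; rewrite (_ : (fun _ => _) = (fun x =>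
      \sum_(y <- finmap.enum_fset (fset_set (range (g n))))
        y * (m x * \1_(g n @^-1` [set y]) (th x)))).
    apply: closed_class_sum => // y; apply: (closed_classZ cW).
    exact/Windic.
  apply/funext => x; rewrite fimfunE fsbig_finite//= mulr_sumr.
  by apply: eq_bigr => y _; rewrite mulrCA.
- move=> n x Dx; rewrite (le_trans _ (mK' x Dx)) // !normrM ler_wpM2l //.
  rewrite !ger0_norm // -lee_fin /g nnsfun_approxE.
  exact: (le_approx n psiE0).
- move=> x Dx; apply: cvgM; first exact: cvg_cst.
  under eq_fun do rewrite /g nnsfun_approxE.
  exact: (@cvg_approx _ _ _ setT (EFin \o psi) (th x) psiE0 I (ltry _)).
Qed.

(** The bound is on the product [m psi(th)], so [psi] may blow up where [m] vanishes; this later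
    allows division by a sine. Positive and negative parts are treated separately. *)
Lemma closed_class_comp psi (K' : R) : measurable_fun setT psi ->
  (forall x, D x -> `|m x * psi (th x)| <= K') ->
  W (fun x => m x * psi (th x)).
Proof.
move=> mpsi mK'.
have Wp : W (fun x => m x * psi^\+ (th x)).
  apply: (Wge0 (K' := K')); [exact: measurable_funrpos|exact: funrpos_ge0|].
  move=> x Dx; rewrite (le_trans _ (mK' x Dx)) // !normrM ler_wpM2l //.
  rewrite ger0_norm ?funrpos_ge0 // -[leRHS]/((Num.norm \o psi) (th x)).
  by rewrite -funrposDneg lerDl funrneg_ge0.
have Wn : W (fun x => m x * psi^\- (th x)).
  apply: (Wge0 (K' := K')); [exact: measurable_funrneg|exact: funrneg_ge0|].
  move=> x Dx; rewrite (le_trans _ (mK' x Dx)) // !normrM ler_wpM2l //.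
  rewrite ger0_norm ?funrneg_ge0 // -[leRHS]/((Num.norm \o psi) (th x)).
  by rewrite -funrposDneg lerDr funrpos_ge0.
have := closed_classB Wp Wn; congr W; apply/funext => x.
by rewrite -mulrBr -[in RHS](funrposBneg psi).
Qed.

End closed_class.

(** * Bounded functions in a closed class containing the root functions *)

Section measurability.
Context {R : realType}.

(** Inversion is continuous off 0, and the convention [0^-1 = 0] agrees with extension by zero from
    there. *)
Lemma measurable_invr : measurable_fun setT (@GRing.inv R).
Proof.
have -> : @GRing.inv R = (@GRing.inv R) \_ (~` [set 0]).
  apply/funext => x; rewrite patchE; case: ifPn => // /negP.
  by rewrite inE /= => /contrapT ->; rewrite invr0.
have o0 : open (~` [set (0 : R)]) by exact/closed_openC/closed_eq.
apply: (iffLR (measurable_restrictT _ _)); first exact: open_measurable.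
apply: open_continuous_measurable_fun => // x; rewrite inE /= => /eqP.
exact: inv_continuous.
Qed.

(* [acos] made Borel on the whole line: outside [-1, 1] it is an unspecified
   choice, and its continuity is only available on the open interval. *)
Definition acosT (x : R) : R := (acos \_ `]-1, 1[) x + pi * \1_[set -1] x.

Lemma measurable_acosT : measurable_fun setT acosT.
Proof.
apply: measurable_funD; last first.
  by apply: measurable_funM => //; exact: measurable_indic.
apply: (iffLR (measurable_restrictT _ _)) => //.
apply: open_continuous_measurable_fun; first exact: interval_open.
by move=> x; rewrite inE /= in_itv /= => h; apply: continuous_acos.
Qed.

Lemma cosTK (t : R) : 0 <= t <= pi -> acosT (cos t) = t.
Proof.
move=> t0pi; have tI : t \in `[0, pi] by rewrite in_itv.
have p0 : pi \in `[0, pi : R] by rewrite in_itv /= lexx pi_ge0.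
have z0 : 0 \in `[0, pi : R] by rewrite in_itv /= lexx pi_ge0.
have [t0 tpi] := andP t0pi.
rewrite /acosT indicE patchE.
have [->|tpi'] := eqVneq t pi.
  rewrite cospi [in X in pi * X]mem_set // mulr1 memNset ?add0r //=.
  by rewrite in_itv /= ltxx.
have tltpi : t < pi by rewrite lt_neqAle tpi'.
have c1 : -1 < cos t by rewrite -cospi ltr_cos.
rewrite [in X in pi * X]memNset ?mulr0 ?addr0; last first.
  by move=> /= e; rewrite e ltxx in c1.
(* [cos 0 = 1] lies outside the open interval, where the default value 0 of the restriction is the
   correct angle. *)
have [->|t0'] := eqVneq t 0.
  by rewrite cos0 memNset //= in_itv /= ltxx andbF.
have c2 : cos t < 1 by rewrite -cos0 ltr_cos // lt_neqAle eq_sym t0'.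
by rewrite mem_set ?cosK //= in_itv /= c1.
Qed.

Lemma measurable_acosT_comp (f : R -> R) (k : R) : measurable_fun setT f ->
  measurable_fun setT (fun u => f (k * acosT u)).
Proof.
move=> mf; apply: (measurableT_comp mf).
by apply: measurable_funM => //; exact: measurable_acosT.
Qed.

End measurability.

Section trig.
Context {R : realType}.
Implicit Types x y t : R.

Lemma sinDpiM x n : sin (x + n%:R * pi) = (-1) ^+ n * sin x.
Proof.
elim: n => [|n IH]; first by rewrite mul0r addr0 mul1r.
by rewrite -natr1 mulrDl mul1r addrA sinDpi IH exprS mulN1r mulNr.
Qed.

End trig.

(** * Stability under multiplication by a cosine *)

Section chebyshev.
Context {R : realType}.
Variables (D : set R) (W : set (R -> R)) (cW : closed_class D W).

(** Multiplication by [c] turns each [F j] into a combination of its neighbours. The edge equation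
    has [k = 1] for cosines from frequency 0, and [k = 1/2] for sines from frequency 1. *)
Lemma chebyshev_closed (F : nat -> R -> R) (c : R -> R) (k : R) :
  (forall n, W (F n)) ->
  (forall x, F 0%N x * c x = k * F 1%N x) ->
  (forall n x, F n.+1 x * c x = 2^-1 * (F n.+2 x + F n x)) ->
  forall n, W (fun x => F 0%N x * c x ^+ n).
Proof.
move=> WF F0 FS n.
(* The induction on [n] needs all indices [j] at once. *)
suff : forall j, W (fun x => F j x * c x ^+ n) by exact.
elim: n => [|n IH] j.
  by under eq_fun do rewrite expr0 mulr1; exact: WF.
case: j => [|j].
  have := closed_classZ cW k (IH 1%N); congr W; apply/funext => x.
  by rewrite exprS [RHS]mulrA F0 mulrA.
have := closed_classZ cW 2^-1 (closed_classD cW (IH j.+2) (IH j)).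
congr W; apply/funext => x.
by rewrite exprS [RHS]mulrA FS -mulrDl mulrA.
Qed.

Lemma closed_class_eq (f g : R -> R) (K : R) : W f ->
  (forall x, D x -> f x = g x) -> (forall x, D x -> `|f x| <= K) -> W g.
Proof.
move=> Wf fg fK; apply: (closed_classL cW (f_ := fun=> f) (K := K)) => //.
by move=> x Dx; rewrite fg //; exact: cvg_cst.
Qed.

End chebyshev.

Section ratios.
Context {F : fieldType}.
Implicit Types p b t : F.

Lemma ratioK p b t : p != 0 -> b != 0 -> b / p * (p / b * t) = t.
Proof. by move=> p0 b0; field; rewrite p0 b0. Qed.

Lemma ratio_reflect p b t : b != 0 ->
  p / b * (2 * b - t) = - (p / b * t) + p *+ 2.
Proof. by move=> b0; field. Qed.

End ratios.

Section product_formulas.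
Context {R : realType}.
Implicit Types y : R.

Lemma sin_natMcos n y :
  sin (n.+1%:R * y) * cos y = 2^-1 * (sin (n.+2%:R * y) + sin (n%:R * y)).
Proof.
have -> : n.+2%:R * y = n.+1%:R * y + y by rewrite -natr1 mulrDl mul1r.
have -> : n%:R * y = n.+1%:R * y - y by rewrite -natr1 mulrDl mul1r addrK.
by rewrite sinD sinB; lra.
Qed.

Lemma cos_natMcos n y :
  cos (n.+1%:R * y) * cos y = 2^-1 * (cos (n.+2%:R * y) + cos (n%:R * y)).
Proof.
have -> : n.+2%:R * y = n.+1%:R * y + y by rewrite -natr1 mulrDl mul1r.
have -> : n%:R * y = n.+1%:R * y - y by rewrite -natr1 mulrDl mul1r addrK.
by rewrite cosD cosB; lra.
Qed.

End product_formulas.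

(** * From the root functions to all bounded functions *)

Section completeness.
Context {R : realType}.
Variables (W : set (R -> R)) (cW : closed_class itvpi W).
Implicit Types f g : R -> R.
Local Notation D := (@itvpi R).

Let msin : measurable_fun setT (@sin R).
Proof. apply: continuous_measurable_fun; exact: continuous_sin. Qed.

Let mcos : measurable_fun setT (@cos R).
Proof. apply: continuous_measurable_fun; exact: continuous_cos. Qed.

Let memD x : D x -> - (pi / 2) < x < pi / 2.
Proof. by rewrite /itvpi /= in_itv. Qed.

Let normD x : D x -> `|x| < pi / 2.
Proof. by move=> /memD; rewrite ltr_norml. Qed.

Let lt2pi (x : R) : x < pi / 2 -> 2 * x < pi.
Proof. by rewrite ltr_pdivlMr // mulrC. Qed.

Let Dnorm (x : R) : `|x| < pi / 2 -> D x.
Proof. by rewrite ltr_norml /itvpi /= in_itv. Qed.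

Section even.
Variables (b c : R).
Hypotheses (b0 : 0 < b) (c0 : 0 < c) (cb : c <= b) (bc : b + c = pi / 2).
Hypothesis Wb : forall n, W (fun x => cos (n%:R * (pi / b * x))).
Hypothesis Wc : forall n, W (fun x => cos (n%:R * (pi / c * x))).
Hypothesis Wx : forall n, (0 < n)%N -> sin (n%:R * (pi / c * b)) = 0 ->
  W (fun x => x * sin (n%:R * (pi / c * x))).

Let fold (x : R) : R := if `|x| <= b then `|x| else 2 * b - `|x|.

Let normbc x : D x -> `|x| < b + c.
Proof. by rewrite bc; exact: normD. Qed.

(** Since [c <= b], [y < b + c <= 2 b]: a single reflection about [b] suffices. *)
Let reflect_itv (y : R) : y < b + c -> b < y -> 0 <= 2 * b - y <= b.
Proof.
move=> ybc yb; have cb' := cb; apply/andP; split; lra.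
Qed.

Let shift_itv (y : R) : y < b + c -> b < y -> 0 < y - b < c.
Proof. by move=> ybc yb; rewrite subr_gt0 yb ltrBlDl. Qed.

(** [cos (pi x / b)] is even and symmetric about [b], so it depends only on [fold x], which lies in
    [[0, b]], where the arccosine inverts it. *)
Let foldK x : D x -> b / pi * acosT (cos (pi / b * x)) = fold x.
Proof.
move=> /normbc xD; have pi0 := pi_gt0 R.
have E t : 0 <= t <= b -> b / pi * acosT (cos (pi / b * t)) = t.
  move=> /andP[t0 tb]; rewrite cosTK; first by rewrite ratioK ?gt_eqF.
  rewrite mulr_ge0 ?divr_ge0 ?pi_ge0 ?(ltW b0) //=.
  by rewrite mulrAC ler_pdivrMr // ler_pM2l.
rewrite -cos_norm normrM (ger0_norm (divr_ge0 (pi_ge0 R) (ltW b0))) /fold.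
case: (leP `|x| b) => xb; first by rewrite E ?normr_ge0.
rewrite -[RHS]E; last exact: reflect_itv.
congr (_ * acosT _).
have -> : pi / b * (2 * b - `|x|) = - (pi / b * `|x|) + pi *+ 2.
  by rewrite ratio_reflect ?gt_eqF.
by rewrite cosD2pi cosN.
Qed.

Let foldD x : D x -> D (fold x).
Proof.
move=> /normbc xD; apply: Dnorm; rewrite -bc /fold.
case: (leP `|x| b) => xb; first by rewrite normr_id.
have /andP[h0 h1] := reflect_itv xD xb.
by rewrite ger0_norm // (le_lt_trans h1) // ltrDl.
Qed.

Let W1 : W (cst 1).
Proof. by have := Wb 0; congr W; apply/funext => x; rewrite mul0r cos0. Qed.

Let cos_class k : (forall n, W (fun x => cos (n%:R * (k * x)))) ->
  forall n, W (fun x => 1 * cos (k * x) ^+ n).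
Proof.
move=> Wk n.
have := chebyshev_closed cW (F := fun n x => cos (n%:R * (k * x)))
  (c := fun x => cos (k * x)) (k := 1) Wk _ _ n.
rewrite (_ : (fun x => cos (0 * _) * _) = (fun x => 1 * cos (k * x) ^+ n)).
  apply; first by move=> x; rewrite mul0r cos0 !mul1r.
  by move=> j x; rewrite cos_natMcos.
by apply/funext => x; rewrite mul0r cos0.
Qed.

(** By [foldK], [f \o fold] agrees on [D] with a Borel function of [cos (pi x / b)], so the monotone
    class argument applies with [m = 1]. *)
Lemma fold_class f (K : R) : measurable_fun setT f ->
  (forall x, D x -> `|f x| <= K) -> W (f \o fold).
Proof.
move=> mf fK.
have fE x : D x ->
    1 * (fun u => f (b / pi * acosT u)) (cos (pi / b * x)) = f (fold x).
  by move=> Dx; rewrite mul1r /= foldK.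
apply: (closed_class_eq cW (f := fun x =>
    1 * (fun u => f (b / pi * acosT u)) (cos (pi / b * x))) (K := K)) => //.
- apply: (@closed_class_comp _ _ _ cW (fun=> 1) (fun x => cos (pi / b * x)) 1 _ _ _
    (fun u => f (b / pi * acosT u)) K).
  + by move=> x _; rewrite normr1.
  + by move=> x _; exact: cos_max.
  + exact: cos_class.
  + exact: measurable_acosT_comp.
  + by move=> x Dx; rewrite fE //; exact/fK/foldD.
- by move=> x Dx; rewrite fE //; exact/fK/foldD.
Qed.

(** The index is shifted by one: [H n] has frequency [(n + 1) pi / c], so that the family starts at
    a non-zero function. *)
Let H n (x : R) : R :=
  if `|x| <= b then 0 else sin (n.+1%:R * (pi / c * (`|x| - b))).

Let HB n x : `|H n x| <= 1.
Proof. by rewrite /H; case: ifP; rewrite ?normr0 // sin_max. Qed.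

(** For even [f], the difference of [f] and [f \o fold] vanishes where [|x| <= b] and is
    [f (b + t) - f (b - t)] at [|x| = b + t]; it is thus [k] times [H n]. *)
Lemma tail_class f (K k : R) n : W f -> measurable_fun setT f ->
  (forall x, D x -> `|f x| <= K) -> (forall x, f `|x| = f x) -> k != 0 ->
  (forall t, 0 < t < c ->
    f (b + t) - f (b - t) = k * sin (n.+1%:R * (pi / c * t))) ->
  W (H n).
Proof.
move=> Wf mf fK fe k0 fk.
have := closed_classZ cW k^-1 (closed_classB cW Wf (fold_class mf fK)).
move=> /(closed_class_eq cW); apply; last first.
  move=> x Dx; apply: (le_trans _ (lexx (`|k^-1| * (K + K)))).
  rewrite normrM ler_wpM2l // (le_trans (ler_normB _ _)) //.
  by rewrite lerD ?fK //; exact: foldD.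
move=> x /normbc xD; rewrite /H /fold /=; case: (leP `|x| b) => xb.
  by rewrite fe subrr mulr0.
have := fk (`|x| - b).
rewrite subrKC fe opprB addrA -(mulr2n b) -(mulr_natl b 2) => -> //.
  by rewrite mulKf.
exact: shift_itv.
Qed.

Let WH n : W (H n).
Proof.
set s := sin (n.+1%:R * (pi / c * b)).
have ct (t : R) : n.+1%:R * (pi / c * (b + t)) =
    n.+1%:R * (pi / c * b) + n.+1%:R * (pi / c * t).
  by rewrite !mulrDr.
have cB (t : R) : n.+1%:R * (pi / c * (b - t)) =
    n.+1%:R * (pi / c * b) - n.+1%:R * (pi / c * t).
  by rewrite !mulrBr.
have [s0|s0] := eqVneq s 0.
  apply: (tail_class (f := fun x => x * sin (n.+1%:R * (pi / c * x)))
    (K := pi / 2) (k := 2 * b * cos (n.+1%:R * (pi / c * b)))).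
  - exact: Wx.
  - apply: measurable_funM => //; apply: (measurableT_comp msin).
    by apply: measurable_funM => //; exact: measurable_funM.
  - move=> x /normD xD; rewrite normrM -[leRHS]mulr1.
    by rewrite ler_pM ?normr_ge0 ?sin_max // ltW.
  - move=> x; case: (leP 0 x) => x0; first by rewrite ger0_norm.
    by rewrite ltr0_norm // !mulrN sinN mulrN mulNr opprK.
  - apply: mulf_neq0; first by rewrite mulf_neq0 ?pnatr_eq0 ?gt_eqF.
    (* A vanishing sine forces the cosine to be 1 or -1. *)
    by rewrite -normr_eq0 (sin0cos1 s0) oner_eq0.
  - move=> t _; rewrite ct cB sinD sinB -/s s0; ring.
apply: (tail_class (f := fun x => cos (n.+1%:R * (pi / c * x)))
  (K := 1) (k := - 2 * s)).
- exact: Wc.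
- apply: (measurableT_comp mcos).
  by apply: measurable_funM => //; exact: measurable_funM.
- by move=> x _; exact: cos_max.
- move=> x; case: (leP 0 x) => x0; first by rewrite ger0_norm.
  by rewrite ltr0_norm // !mulrN cosN.
- by rewrite mulf_neq0 // oppr_eq0 pnatr_eq0.
- move=> t _; rewrite ct cB cosD cosB -/s; ring.
Qed.

(** [f] is [f \o fold] plus a difference that vanishes for [|x| <= b] and is written as [H 0] times
    a function of [th]. *)
Lemma even_class f (K : R) : measurable_fun setT f ->
  (forall x, D x -> `|f x| <= K) -> (forall x, f (- x) = f x) -> W f.
Proof.
move=> mf fK fN.
have fe x : f `|x| = f x.
  by case: (leP 0 x) => x0; [rewrite ger0_norm|rewrite ltr0_norm].
pose th (x : R) := cos (pi / c * (`|x| - b)).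
(* At [u = th x] with [|x| > b], [c / pi * acosT u] is [|x| - b]; the first factor is then
   [f x - f (fold x)], and the second cancels the sine in [H 0]. The multiplier 1 gives the sine the
   shape treated by [measurable_acosT_comp]. *)
pose psi u := (f (b + c / pi * acosT u) - f (b - c / pi * acosT u)) *
  (sin (1 * acosT u))^-1.
have E x : D x -> H 0 x * psi (th x) = f x - f (fold x).
  move=> /normbc xD; rewrite /H /fold; case: (leP `|x| b) => xb.
    by rewrite mul0r fe subrr.
  have pi0 := pi_gt0 R.
  have y0 : 0 < pi / c * (`|x| - b) by rewrite !mulr_gt0 ?invr_gt0 // subr_gt0.
  have y1 : pi / c * (`|x| - b) < pi.
    by rewrite mulrAC ltr_pdivrMr // ltr_pM2l // ltrBlDl.
  rewrite /psi /th cosTK ?(ltW y0) ?(ltW y1) // mul1r.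
  have -> : c / pi * (pi / c * (`|x| - b)) = `|x| - b.
    by rewrite ratioK ?gt_eqF.
  rewrite subrKC fe opprB addrA -(mulr2n b) -(mulr_natl b 2) mulrC mulfVK //.
  by rewrite gt_eqF // sin_gt0_pi // y0.
have fB x : D x -> `|f x - f (fold x)| <= K + K.
  move=> Dx; rewrite (le_trans (ler_normB _ _)) // lerD ?fK //; exact: foldD.
have Wd : W (fun x => H 0 x * psi (th x)).
  apply: (@closed_class_comp _ _ _ cW (H 0) th 1 _ _ _ psi (K + K)).
  - by move=> x _; exact: HB.
  - by move=> x _; exact: cos_max.
  - apply: (chebyshev_closed cW (k := 2^-1)) => //.
      move=> x; rewrite /H /th; case: ifP => _; first by rewrite mul0r mulr0.
      by rewrite sin_natMcos mul0r sin0 addr0.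
    move=> n x; rewrite /H /th; case: ifP => _; first by rewrite mul0r addr0 mulr0.
    by rewrite sin_natMcos.
  - apply: measurable_funM.
      apply: measurable_funB.
        apply: (measurable_acosT_comp (f := fun z => f (b + z))).
        by apply: (measurableT_comp mf); exact: measurable_funD.
      apply: (measurable_acosT_comp (f := fun z => f (b - z))).
      by apply: (measurableT_comp mf); exact: measurable_funB.
    apply: (measurableT_comp measurable_invr).
    exact: (measurable_acosT_comp _ msin).
  - by move=> x Dx; rewrite E //; exact: fB.
have := closed_classD cW Wd (fold_class mf fK).
move=> /(closed_class_eq cW); apply => [x Dx|x Dx]; rewrite /= E // subrK //.
exact: fK.
Qed.

End even.

Hypothesis Weven : forall f (K : R), measurable_fun setT f ->
  (forall x, D x -> `|f x| <= K) -> (forall x, f (- x) = f x) -> W f.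
Hypothesis Wodd : forall n, exists k : R,
  W (fun x => k * cos (n.+1%:R * (2 * x)) + sin (n.+1%:R * (2 * x))).

(** Subtracting the even cosine term leaves the pure sines [sin (2 (n + 1) x)]. The monotone class
    argument then runs with [m = sin (2 x)] and [th = cos (2 x)]. *)
Lemma odd_class f (K : R) : measurable_fun setT f ->
  (forall x, D x -> `|f x| <= K) -> (forall x, f (- x) = - f x) -> W f.
Proof.
move=> mf fK fN.
have Ws n : W (fun x => sin (n.+1%:R * (2 * x))).
  have [k Wk] := Wodd n.
  have Wc : W (fun x => cos (n.+1%:R * (2 * x))).
    apply: (Weven (K := 1)).
    - apply: (measurableT_comp mcos).
      by apply: measurable_funM => //; exact: measurable_funM.
    - by move=> x _; exact: cos_max.
    - by move=> x; rewrite !mulrN cosN.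
  have := closed_classB cW Wk (closed_classZ cW k Wc); congr W.
  by apply/funext => x; rewrite addrC addKr.
(* Chosen so that [psi (cos (2 x))] is [f x / sin (2 x)] for [0 < x < pi / 2]. Oddness extends the
   identity to negative [x], and gives [f 0 = 0]. *)
pose psi u := f (2^-1 * acosT u) * (sin (1 * acosT u))^-1.
have E0 x : 0 < x < pi / 2 ->
    sin (1 * (2 * x)) * psi (cos (2 * x)) = f x.
  move=> /andP[x0 x1].
  have x2 := ltW (lt2pi x1).
  rewrite /psi cosTK; last by rewrite x2 mulr_ge0 // ltW.
  rewrite !mul1r mulKf ?pnatr_eq0 // mulrC mulfVK //.
  by rewrite gt_eqF // sin_gt0_pi // lt2pi // mulr_gt0.
have E x : D x -> sin (1 * (2 * x)) * psi (cos (2 * x)) = f x.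
  move=> /memD /andP[x1 x2]; case: (ltgtP x 0) => x0.
  - rewrite -(opprK x) fN -[in RHS]E0; last by rewrite oppr_gt0 x0 ltrNl.
    by rewrite !mulrN sinN cosN mulNr.
  - by rewrite E0 // x0.
  - have f0 : f 0 = 0 by have := fN 0; rewrite oppr0; lra.
    by rewrite x0 f0 !mulr0 sin0 mul0r.
have W' : W (fun x => sin (1 * (2 * x)) * psi (cos (2 * x))).
  apply: (@closed_class_comp _ _ _ cW (fun x => sin (1 * (2 * x)))
    (fun x => cos (2 * x)) 1 _ _ _ psi K).
  - by move=> x _; exact: sin_max.
  - by move=> x _; exact: cos_max.
  - apply: (chebyshev_closed cW (k := 2^-1)
      (F := fun n x => sin (n.+1%:R * (2 * x)))) => //.
      by move=> x; rewrite sin_natMcos mul0r sin0 addr0.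
    by move=> n x; rewrite sin_natMcos.
  - apply: measurable_funM; first exact: measurable_acosT_comp.
    apply: (measurableT_comp measurable_invr).
    exact: (measurable_acosT_comp _ msin).
  - by move=> x Dx; rewrite E //; exact: fK.
by move: W' => /(closed_class_eq cW); apply => x Dx; rewrite E //; exact: fK.
Qed.

Lemma bounded_class f (K : R) : measurable_fun setT f ->
  (forall x, D x -> `|f x| <= K) -> W f.
Proof.
move=> mf fK.
have mN : measurable_fun setT (fun x : R => f (- x)).
  by apply: (measurableT_comp mf); exact: measurable_funN.
have fKN x : D x -> `|f (- x)| <= K.
  by move=> /normD xD; apply/fK/Dnorm; rewrite normrN.
have We : W (fun x => 2^-1 * (f x + f (- x))).
  apply: (Weven (K := K)).
  - by apply: measurable_funM => //; exact: measurable_funD.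
  - move=> x Dx; rewrite normrM gtr0_norm ?invr_gt0 // ler_pdivrMl //.
    rewrite (le_trans (ler_normD _ _)) // mulr_natl mulr2n.
    by rewrite lerD ?fKN ?fK.
  - by move=> x; rewrite opprK addrC.
have Wo : W (fun x => 2^-1 * (f x - f (- x))).
  apply: (odd_class (K := K)).
  - by apply: measurable_funM => //; exact: measurable_funB.
  - move=> x Dx; rewrite normrM gtr0_norm ?invr_gt0 // ler_pdivrMl //.
    rewrite (le_trans (ler_normB _ _)) // mulr_natl mulr2n.
    by rewrite lerD ?fKN ?fK.
  - by move=> x; rewrite opprK -mulrN opprB.
have := closed_classD cW We Wo; congr W; apply/funext => x; lra.
Qed.

End completeness.

(** * Square-integrable functions and weak derivatives *)

Section square_integrable.
Context {R : realType}.
Local Notation mu := (@lebesgue_measure R).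
Variables (D : set R) (mD : measurable D).
Implicit Types (f g h : R -> R).

Definition sqint f : \bar R := (\int[mu]_(x in D) (f x ^+ 2)%:E)%E.

Definition square_integrable f : Prop :=
  measurable_fun D f /\ (sqint f < +oo)%E.

Let measurable_sqr f : measurable_fun D f ->
  measurable_fun D (fun x => (f x ^+ 2)%:E).
Proof. by move=> mf; apply/measurable_EFinP; exact: measurable_funX. Qed.

Lemma sqint_ge0 f : (0 <= sqint f)%E.
Proof. by apply: integral_ge0 => x _; rewrite lee_fin sqr_ge0. Qed.

(** [2 f^2 + 2 g^2 - (f + g)^2 = (f - g)^2]. This replaces the triangle inequality, and its factor 2
    explains the tolerances [e / 4] used for sums. *)
Lemma sqintD f g : measurable_fun D f -> measurable_fun D g ->
  (sqint (fun x => (f x + g x)%R) <= 2%:E * sqint f + 2%:E * sqint g)%E.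
Proof.
move=> mf mg; rewrite /sqint.
rewrite -!ge0_integralZl_EFin//; try by
  [move=> x _; rewrite lee_fin sqr_ge0 | exact: measurable_sqr].
have m2 h : measurable_fun D h -> measurable_fun D (fun x => (2 * h x ^+ 2)%:E).
  move=> mh; apply/measurable_EFinP; apply: measurable_funM => //.
  exact: measurable_funX.
rewrite -ge0_integralD//; try by
  [move=> x _; rewrite lee_fin mulr_ge0 // sqr_ge0 | exact: m2].
apply: ge0_le_integral => //.
- by move=> x _; rewrite lee_fin sqr_ge0.
- by apply: measurable_sqr; exact: measurable_funD.
- by apply: emeasurable_funD; exact: m2.
- move=> x _; rewrite lee_fin -subr_ge0.
  by rewrite (_ : _ - _ = (f x - g x) ^+ 2) ?sqr_ge0 //; ring.
Qed.

Lemma sqintZ c f : measurable_fun D f ->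
  sqint (fun x => c * f x) = ((c ^+ 2)%:E * sqint f)%E.
Proof.
move=> mf; rewrite /sqint -ge0_integralZl_EFin ?sqr_ge0//.
- by apply: eq_integral => x _; rewrite exprMn.
- by move=> x _; rewrite lee_fin sqr_ge0.
- exact: measurable_sqr.
Qed.

Lemma square_integrableD f g : square_integrable f -> square_integrable g ->
  square_integrable (fun x => f x + g x).
Proof.
move=> [mf f2] [mg g2]; split; first exact: measurable_funD.
apply: (le_lt_trans (sqintD mf mg)).
by rewrite lte_add_pinfty // lte_mul_pinfty // ?sqint_ge0.
Qed.

Lemma square_integrableZ c f : square_integrable f ->
  square_integrable (fun x => c * f x).
Proof.
move=> [mf f2]; split; first exact: measurable_funM.
by rewrite sqintZ // lte_mul_pinfty // lee_fin sqr_ge0.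
Qed.

Lemma square_integrable0 : square_integrable (cst 0).
Proof.
split; first exact: measurable_cst.
rewrite /sqint (eq_integral (cst 0%E)) ?integral0 ?ltry //.
by move=> x _; rewrite expr0n.
Qed.

Variable S : set (R -> R).
Hypotheses (SD : forall f g, S f -> S g -> S (fun x => f x + g x))
  (SZ : forall c f, S f -> S (fun x => c * f x))
  (S2 : forall f, S f -> square_integrable f).

(** The tolerance [e] bounds the squared distance. *)
Definition L2_closure : set (R -> R) := [set f : R -> R | measurable_fun D f /\
  forall e : R, 0 < e ->
    exists2 g, S g & (sqint (fun x => (f x - g x)%R) < e%:E)%E].

Lemma L2_closure_id f : S f -> L2_closure f.
Proof.
move=> Sf; have [mf _] := S2 Sf; split => // e e0; exists f => //.
rewrite /sqint (eq_integral (cst 0%E)) ?integral0 ?lte_fin //.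
by move=> x _; rewrite subrr expr0n.
Qed.

Lemma L2_closureD f g : L2_closure f -> L2_closure g ->
  L2_closure (fun x => f x + g x).
Proof.
move=> [mf fe] [mg ge]; split; first exact: measurable_funD.
move=> e e0; have e4 : 0 < e / 4 by rewrite divr_gt0.
have [f' Sf' f'e] := fe _ e4; have [g' Sg' g'e] := ge _ e4.
exists (fun x => f' x + g' x); first exact: SD.
have [[mf' _] [mg' _]] := (S2 Sf', S2 Sg').
rewrite (_ : (fun x => _) = (fun x => (f x - f' x) + (g x - g' x))); last first.
  by apply/funext => x; ring.
apply: (@le_lt_trans _ _ _ _ _ (sqintD _ _)); [exact: measurable_funB..|].
rewrite (_ : e%:E = (2%:E * (e / 4)%:E + 2%:E * (e / 4)%:E)%E); last first.
  by rewrite -EFinM -EFinD; congr EFin; field.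
by rewrite lteD // lte_pmul2l.
Qed.

Lemma L2_closureZ c f : L2_closure f -> L2_closure (fun x => c * f x).
Proof.
move=> [mf fe]; split; first exact: measurable_funM.
(* The summand 1 covers [c = 0]. *)
move=> e e0; have c1 : 0 < c ^+ 2 + 1 by rewrite ltr_wpDl ?sqr_ge0.
have [g Sg ge] := fe _ (divr_gt0 e0 c1).
exists (fun x => c * g x); first exact: SZ.
have [mg _] := S2 Sg.
rewrite (_ : (fun x => _) = (fun x => c * (f x - g x))); last first.
  by apply/funext => x; ring.
rewrite sqintZ; last exact: measurable_funB.
apply: (@le_lt_trans _ _ ((c ^+ 2)%:E * (e / (c ^+ 2 + 1))%:E)%E).
  by rewrite lee_wpmul2l ?lee_fin ?sqr_ge0 // ltW.
rewrite -EFinM lte_fin mulrCA -[ltRHS]mulr1 ltr_pM2l //.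
by rewrite ltr_pdivrMr // mul1r ltrDl.
Qed.

(** Dominated convergence brings some [f_ N] close to [f], and an element of [S] is close to [f_ N].
    The general majorant [h] serves two cases: a constant for bounded limits, and [f^2] for
    truncations. *)
Lemma L2_closure_dominated (f_ : nat -> R -> R) f (h : R -> R) :
  (forall n, L2_closure (f_ n)) ->
  mu.-integrable D (EFin \o h) ->
  (forall n x, D x -> (f x - f_ n x) ^+ 2 <= h x) ->
  (forall x, D x -> f_ n x @[n --> \oo] --> f x) -> L2_closure f.
Proof.
move=> Wf_ ih fh f_f.
have mf_ n : measurable_fun D (f_ n) by have [] := Wf_ n.
have mf : measurable_fun D f by apply: measurable_fun_cvg f_f.
split => // e e0; have e4 : 0 < e / 4 by rewrite divr_gt0.
have cv : sqint (fun x => (f x - f_ n x)%R) @[n --> \oo] --> 0%E.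
  have [] := @dominated_convergence _ _ _ mu D mD
    (fun n x => ((f x - f_ n x) ^+ 2)%:E) (cst 0%E) (EFin \o h) _ _ _ ih.
  - by move=> n; apply: measurable_sqr; exact: measurable_funB.
  - exact: measurable_cst.
  - apply: aeW => x Dx; apply: cvg_EFin; first by near=> n.
    have d0 : f x - f_ n x @[n --> \oo] --> (0 : R).
      rewrite -[X in _ --> X](subrr (f x)).
      by apply: cvgB; [exact: cvg_cst|exact: f_f].
    rewrite -[X in _ --> X](mulr0 0); under eq_fun do rewrite /= expr2.
    exact: cvgM.
  - by apply: aeW => x n Dx; rewrite gee0_abs ?lee_fin ?sqr_ge0 // fh.
  - by move=> _ _; rewrite integral0.
have /cv [N _ /(_ N (leqnn N)) /= fN] : nbhs 0%E [set y | (y < (e / 4)%:E)%E].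
  by apply: open_ereal_lt'; rewrite lte_fin.
have [g Sg ge] := (Wf_ N).2 _ e4; have [mg _] := S2 Sg.
exists g => //.
rewrite (_ : (fun x => _) = (fun x => (f x - f_ N x) + (f_ N x - g x))); last first.
  by apply/funext => x; ring.
apply: (@le_lt_trans _ _ _ _ _ (sqintD _ _)); [exact: measurable_funB..|].
rewrite (_ : e%:E = (2%:E * (e / 4)%:E + 2%:E * (e / 4)%:E)%E); last first.
  by rewrite -EFinM -EFinD; congr EFin; field.
by rewrite lteD // lte_pmul2l.
Unshelve. all: by end_near. Qed.

Hypothesis muD : (mu D < +oo)%E.

Lemma integrable_cst_on (k : R) : mu.-integrable D (EFin \o cst k).
Proof.
apply/integrableP; split; first by apply/measurable_EFinP; exact: measurable_cst.
rewrite (_ : (fun x => _) = cst `|k|%:E); last exact/funext.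
by rewrite integral_cst // lte_mul_pinfty.
Qed.

(** The limit obeys the bound [K] too, so the squared errors are at most [(2 K)^2], a constant,
    which is integrable on a set of finite measure. *)
Lemma L2_closure_closed : closed_class D L2_closure.
Proof.
split; [exact: L2_closureD|exact: L2_closureZ|].
move=> f_ f K Wf fK f_f.
apply: (L2_closure_dominated Wf (integrable_cst_on ((K + K) ^+ 2))) => //.
move=> n x Dx; have fxK : `|f x| <= K.
  apply: (ler_cvg_to (cvg_norm (f_f x Dx)) (cvg_cst K)).
  by near=> m; exact: fK.
rewrite -real_normK ?num_real //= lerXn2r ?nnegrE //.
- by rewrite addr_ge0 // (le_trans _ fxK).
- by rewrite (le_trans (ler_normB _ _)) // lerD // fK.
Unshelve. all: by end_near. Qed.

(** The truncations [t n] replace values above [n] in modulus by 0, so that the squared error is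
    either [f^2] or 0. *)
Lemma L2_closure_bounded :
  (forall f (K : R), measurable_fun setT f -> (forall x, D x -> `|f x| <= K) ->
    L2_closure f) ->
  forall f, square_integrable f -> L2_closure f.
Proof.
move=> Wb f [mf f2].
(* Extension by 0 makes the truncations measurable on the whole line, as the assumption on bounded
   functions demands. *)
have mf' : measurable_fun setT (f \_ D) by exact/(measurable_restrictT _ mD).
pose t n y : R := if `|y| <= n%:R then y else 0.
have mt n : measurable_fun setT (t n).
  apply: measurable_fun_ifT => //.
  by apply: measurable_fun_ler => //; exact: measurableT_comp.
apply: (@L2_closure_dominated (fun n x => t n ((f \_ D) x)) f
  (fun x => f x ^+ 2)).
- move=> n; apply: (Wb _ n%:R).
    by apply: measurableT_comp.
  by move=> x _; rewrite /t; case: ifP; rewrite ?normr0.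
- apply/integrableP; split; first exact: measurable_sqr.
  apply: le_lt_trans f2; rewrite /sqint le_eqVlt; apply/orP; left; apply/eqP.
  by apply: eq_integral => x _; rewrite gee0_abs // lee_fin sqr_ge0.
- move=> n x Dx; rewrite patchE mem_set // /t; case: ifP => _.
    by rewrite subrr expr0n sqr_ge0.
  by rewrite subr0.
- move=> x Dx; apply: cvg_near_cst; near=> n.
  rewrite patchE mem_set // /t ifT //.
  near: n; exact: nbhs_infty_ger.
Unshelve. all: by end_near. Qed.

Lemma square_integrable_bounded f (K : R) : measurable_fun D f ->
  (forall x, D x -> `|f x| <= K) -> square_integrable f.
Proof.
move=> mf fK; split => //.
apply: (@le_lt_trans _ _ (\int[mu]_(x in D) (cst (K ^+ 2)%:E x))%E).
  apply: ge0_le_integral => //.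
  - by move=> x _; rewrite lee_fin sqr_ge0.
  - exact: measurable_sqr.
  - move=> x Dx; rewrite lee_fin -real_normK ?num_real // lerXn2r ?nnegrE ?fK //.
    by rewrite (le_trans _ (fK x Dx)).
by rewrite integral_cst // lte_mul_pinfty // lee_fin sqr_ge0.
Qed.

End square_integrable.

Local Open Scope complex_scope.

(** * Complex [L^2] through real and imaginary parts *)

Section complex_L2.
Context {R : realType}.
Variables (D : set R) (mD : measurable D).
Implicit Types (f g : R -> R[i]).
Local Notation mu := (@lebesgue_measure R).
Local Notation Re := complex.Re.
Local Notation Im := complex.Im.

Lemma L2norm_sqint f : measurable_fun D (fun x => Re (f x)) ->
  measurable_fun D (fun x => Im (f x)) ->
  L2norm D f =
    ((sqint D (fun x => Re (f x)) + sqint D (fun x => Im (f x))) `^ 2^-1)%E.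
Proof.
move=> mr mi; rewrite /L2norm unlock; congr (_ `^ _)%E.
rewrite /sqint -ge0_integralD//; last first.
- by apply/measurable_EFinP; exact: measurable_funX.
- by move=> x _; rewrite lee_fin sqr_ge0.
- by apply/measurable_EFinP; exact: measurable_funX.
- by move=> x _; rewrite lee_fin sqr_ge0.
rewrite [RHS]integral_mkcond; apply: eq_integral => x _.
rewrite !patchE; case: ifP => _; last by rewrite abse0 poweR0r ?pnatr_eq0.
rewrite /= powR_mulrn ?normr_ge0 // real_normK ?num_real //.
by case: (f x) => a b /=; rewrite sqr_sqrtr // addr_ge0 // sqr_ge0.
Qed.

Lemma L2P f : L2 D f <-> square_integrable D (fun x => Re (f x)) /\
  square_integrable D (fun x => Im (f x)).
Proof.
split=> [[mr mi]|[[mr fr] [mi fi]]].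
  rewrite L2norm_sqint // => /lty_poweRy; rewrite invr_eq0 pnatr_eq0 => /(_ isT).
  have r0 := @sqint_ge0 R D (fun x => Re (f x)).
  have i0 := @sqint_ge0 R D (fun x => Im (f x)).
  by move=> h; split; split => //; apply: le_lt_trans h;
    rewrite ?leeDl ?leeDr.
by split => //; rewrite L2norm_sqint // poweR_lty // lte_add_pinfty.
Qed.

Lemma L2norm_lt f (e : R) : 0 < e -> measurable_fun D (fun x => Re (f x)) ->
  measurable_fun D (fun x => Im (f x)) ->
  (sqint D (fun x => Re (f x)) < (e ^+ 2 / 2)%:E)%E ->
  (sqint D (fun x => Im (f x)) < (e ^+ 2 / 2)%:E)%E ->
  (L2norm D f < e%:E)%E.
Proof.
move=> e0 mr mi fr fi; rewrite L2norm_sqint //.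
have : (sqint D (fun x => Re (f x)) + sqint D (fun x => Im (f x)) <
    (e ^+ 2)%:E)%E.
  rewrite (_ : e ^+ 2 = e ^+ 2 / 2 + e ^+ 2 / 2); last by field.
  by rewrite EFinD lteD.
have : (0 <= sqint D (fun x => Re (f x)) + sqint D (fun x => Im (f x)))%E.
  by rewrite adde_ge0 ?sqint_ge0.
case: (_ + _)%E => // r; rewrite lee_fin lte_fin => r0 re.
by rewrite poweR12_sqrt ?lee_fin //= lte_fin -(ger0_norm (ltW e0)) -sqrtr_sqr
  ltr_sqrt // exprn_gt0.
Qed.

Lemma L2D f g : L2 D f -> L2 D g -> L2 D (fun x => f x + g x).
Proof.
move=> /L2P[fr fi] /L2P[gr gi]; apply/L2P; split.
  rewrite (_ : (fun x => _) = (fun x => Re (f x) + Re (g x))).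
    exact: square_integrableD.
  by apply/funext => x; rewrite raddfD.
rewrite (_ : (fun x => _) = (fun x => Im (f x) + Im (g x))).
  exact: square_integrableD.
by apply/funext => x; rewrite raddfD.
Qed.

Lemma L2Z (c : R[i]) f : L2 D f -> L2 D (fun x => c * f x).
Proof.
move=> /L2P[fr fi]; apply/L2P; case: c => a b; split.
  rewrite (_ : (fun x => _) = (fun x => a * Re (f x) + - b * Im (f x))).
    by apply: square_integrableD => //; exact: square_integrableZ.
  by apply/funext => x; case: (f x) => u v /=; rewrite mulNr.
rewrite (_ : (fun x => _) = (fun x => a * Im (f x) + b * Re (f x))).
  by apply: square_integrableD => //; exact: square_integrableZ.
by apply/funext => x; case: (f x).
Qed.

Lemma L2_0 : L2 D (cst 0).
Proof. by apply/L2P; split; exact: square_integrable0. Qed.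

Lemma L2_real (u : R -> R) : square_integrable D u -> L2 D (fun x => (u x)%:C).
Proof. by move=> u2; apply/L2P; split => //; exact: square_integrable0. Qed.

End complex_L2.

(** * Linear spans *)

Section spans.
Context {R : realType}.
Implicit Types (S : set (R -> R[i])) (f g : R -> R[i]).

Lemma lin_spanD S f g : lin_span S f -> lin_span S g ->
  lin_span S (fun x => f x + g x).
Proof.
move=> [n [c [u [Su ->]]]] [m [d [v [Sv ->]]]].
exists (n + m)%N, (fun i => match fintype.split i with inl j => c j | inr j => d j end),
  (fun i => match fintype.split i with inl j => u j | inr j => v j end); split.
  by move=> i; case: fintype.split.
apply/funext => x; rewrite big_split_ord; congr (_ + _); apply: eq_bigr => i _.
  by rewrite (unsplitK (inl i)).
by rewrite (unsplitK (inr i)).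
Qed.

Lemma lin_spanZ S (a : R[i]) f : lin_span S f -> lin_span S (fun x => a * f x).
Proof.
move=> [n [c [u [Su ->]]]]; exists n, (fun i => a * c i), u; split => //.
by apply/funext => x; rewrite mulr_sumr; apply: eq_bigr => i _; rewrite mulrA.
Qed.

Lemma lin_span0 S : lin_span S (cst 0).
Proof.
exists 0%N, (fun=> 0), (fun=> cst 0); split; first by case.
by apply/funext => x; rewrite big_ord0.
Qed.

Lemma lin_span_id S f : S f -> lin_span S f.
Proof.
move=> Sf; exists 1%N, (fun=> 1), (fun=> f); split => //.
by apply/funext => x; rewrite big_ord1 mul1r.
Qed.

Lemma lin_span_L2 (D : set R) S : measurable D ->
  S `<=` L2 D -> lin_span S `<=` L2 D.
Proof.
move=> mD SL _ [n [c [u [Su ->]]]].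
elim: n => [|n IH] in c u Su *.
  rewrite (_ : (fun x => _) = cst 0); first exact: L2_0.
  by apply/funext => x; rewrite big_ord0.
rewrite (_ : (fun x => _) = (fun x => c ord0 * u ord0 x +
    \sum_(i < n) c (lift ord0 i) * u (lift ord0 i) x)).
  apply: L2D => //; first by apply: L2Z => //; exact: SL.
  by apply: IH => i; exact: Su.
by apply/funext => x; rewrite big_ord_recl.
Qed.

End spans.

(** * Weak derivatives of smooth functions, and the domain of [opH] *)

Section weak_derivatives.
Context {R : realType}.
Local Notation D := (@itvpi R).
Local Notation mu := (@lebesgue_measure R).
Implicit Types u phi : R -> R.

Lemma measurable_itvpi : measurable D.
Proof. exact: measurable_itv. Qed.

Lemma pihalf_lt : - (pi / 2) < pi / 2 :> R.
Proof. by rewrite gtrN // divr_gt0 // pi_gt0. Qed.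

Lemma itvpi_lty : (mu D < +oo)%E.
Proof. by rewrite /itvpi lebesgue_measure_itv /=; case: ifP; rewrite ?ltry. Qed.

Lemma derivable_continuous u : (forall x, derivable u x 1) -> continuous u.
Proof. by move=> du x; apply/differentiable_continuous/derivable1_diffP. Qed.

Lemma continuous_square_integrable u : continuous u -> square_integrable D u.
Proof.
move=> cu; have cw : {within `[- (pi / 2), pi / 2], continuous u}.
  exact: continuous_subspaceT.
have [c _ cM] := EVT_max (ltW pihalf_lt) cw.
have [d _ dM] := EVT_min (ltW pihalf_lt) cw.
apply: (@square_integrable_bounded _ _ measurable_itvpi itvpi_lty _
  (`|u c| + `|u d|)).
  by apply: measurable_funTS; exact: continuous_measurable_fun.
move=> x; rewrite /itvpi /= in_itv /= => /andP[x1 x2].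
have xI : x \in `[- (pi / 2), pi / 2] by rewrite in_itv /= !ltW.
have := cM x xI; have := dM x xI; rewrite ler_norml => h1 h2.
have := ler_norm (u c); have := ler_norm (- u d); rewrite normrN.
have := normr_ge0 (u c); have := normr_ge0 (u d).
by move=> *; apply/andP; split; lra.
Qed.

Lemma derivable_LR u (a b : R) : (forall x, derivable u x 1) ->
  derivable_oo_LRcontinuous u a b.
Proof.
move=> du; have cu := derivable_continuous du; split => //.
  by apply: cvg_at_right_filter; exact: cu.
by apply: cvg_at_left_filter; exact: cu.
Qed.

(** The endpoints are null, so the integrals may be taken over the closed interval, where
    integration by parts applies; [phi] kills the boundary terms. *)
Lemma itvpi_parts u phi : (forall x, derivable u x 1) ->
  (forall x, derivable phi x 1) -> continuous (derive1 u) -> continuous (derive1 phi) ->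
  phi (- (pi / 2)) = 0 -> phi (pi / 2) = 0 ->
  \int[mu]_(x in D) (u x * (derive1 phi) x) = - \int[mu]_(x in D) ((derive1 u) x * phi x).
Proof.
move=> du dphi cu' cphi' p1 p2.
have cu := derivable_continuous du; have cphi := derivable_continuous dphi.
have E v : continuous v -> \int[mu]_(x in D) v x =
    \int[mu]_(x in `[- (pi / 2), pi / 2]) v x.
  move=> cv; rewrite /Rintegral /itvpi; apply: (congr1 fine); apply/esym.
  apply: (@integral_itv_bndoo _ _ _ (EFin \o v)).
  apply/measurable_EFinP/measurable_funTS; exact: continuous_measurable_fun.
rewrite !E; last 2 first.
- by move=> x; apply: cvgM; [exact: cu'|exact: cphi].
- by move=> x; apply: cvgM; [exact: cu|exact: cphi'].
have -> := @Rintegration_by_parts R u phi (derive1 u) (derive1 phi) _ _ pihalf_lt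
  (continuous_subspaceT cu') (derivable_LR _ _ du) (fun _ _ => erefl)
  (continuous_subspaceT cphi') (derivable_LR _ _ dphi) (fun _ _ => erefl).
by rewrite p1 p2 !mulr0 subrr sub0r.
Qed.

(** The closed support lies in [D], so [phi] vanishes on a whole neighbourhood of [y]. *)
Lemma test_function_bnd phi (y : R) n : test_function D phi -> ~ D y ->
  derive1n n phi y = 0.
Proof.
move=> [_ [sD _]] nDy.
have : \forall x \near y, phi x = 0.
  have o : open (~` closure [set x | phi x != 0]).
    by apply: closed_openC; exact: closed_closure.
  have : nbhs y (~` closure [set x | phi x != 0]).
    by apply: open_nbhs_nbhs; split => // /sD.
  apply: filterS => x nx; apply/eqP/negPn/negP => px; apply: nx.
  exact: subset_closure.
(* Vanishing near [y], unlike vanishing at [y] alone, passes to derivatives. *)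
move=> h; suff : \forall x \near y, derive1n n phi x = 0 by exact: nbhs_singleton.
elim: n => [//|n IH].
rewrite derive1nS; have := near_join IH; apply: filterS => x hx.
rewrite derive1E (near_eq_derive (g := cst 0)) ?derive_cst //.
Qed.

Lemma cintegral_real u phi :
  cintegral D (fun x => (u x)%:C * (phi x)%:C) =
  (\int[mu]_(x in D) (u x * phi x))%:C.
Proof.
rewrite /cintegral; congr (_ +i* _).
  by apply: eq_Rintegral => x _ /=; rewrite mulr0 subr0.
rewrite (_ : (fun x => _) = cst 0) ?Rintegral_cst ?mul0r //; first exact: measurable_itvpi.
by apply/funext => x /=; rewrite mulr0 mul0r addr0.
Qed.

Variables (u u1 u2 : R -> R).
Hypothesis du : forall x : R, is_derive x 1 u (u1 x).
Hypothesis du1 : forall x : R, is_derive x 1 u1 (u2 x).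
Hypothesis cu2 : continuous u2.

Let u1E : (derive1 u) = u1.
Proof. by apply/funext => x; rewrite derive1E derive_val. Qed.

Let u2E : (derive1 u1) = u2.
Proof. by apply/funext => x; rewrite derive1E derive_val. Qed.

Let du' x : derivable u x 1.
Proof. exact: (@ex_derive _ _ _ _ _ _ _ (du x)). Qed.

Let du1' x : derivable u1 x 1.
Proof. exact: (@ex_derive _ _ _ _ _ _ _ (du1 x)). Qed.

Let cu1 : continuous u1 := derivable_continuous du1'.
Let cu : continuous u := derivable_continuous du'.

Let nDl : ~ D (- (pi / 2)).
Proof. by rewrite /itvpi /= in_itv /= ltxx. Qed.

Let nDr : ~ D (pi / 2).
Proof. by rewrite /itvpi /= in_itv /= ltxx andbF. Qed.

Lemma weak_derivative1 :
  weak_derivative D 1 (fun x => (u x)%:C) (fun x => (u1 x)%:C).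
Proof.
move=> phi tphi; rewrite !cintegral_real expr1 mulN1r -rmorphN; congr (_%:C).
have [dphi _] := tphi; rewrite derive1n1 -u1E itvpi_parts //.
- exact: (dphi 0%N).
- by rewrite u1E.
- exact/derivable_continuous/(dphi 1%N).
- exact: (test_function_bnd 0 tphi).
- exact: (test_function_bnd 0 tphi).
Qed.

(** Two integrations by parts, whose boundary terms vanish because [phi] and its derivative are 0 at
    both ends. *)
Lemma weak_derivative2 :
  weak_derivative D 2 (fun x => (u x)%:C) (fun x => (u2 x)%:C).
Proof.
move=> phi tphi; rewrite !cintegral_real sqrrN expr1n mul1r; congr (_%:C).
have [dphi _] := tphi.
have c1 : continuous (derive1 phi) by exact/derivable_continuous/(dphi 1%N).
have c2 : continuous (derive1 (derive1 phi)).
  exact/derivable_continuous/(dphi 2%N).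
have p0 y : ~ D y -> phi y = 0 by exact: (test_function_bnd 0 tphi).
have p1 y : ~ D y -> derive1 phi y = 0 by exact: (test_function_bnd 1 tphi).
have cu1' : continuous (derive1 u) by rewrite u1E.
have cu2' : continuous (derive1 u1) by rewrite u2E.
rewrite (itvpi_parts du' (dphi 1%N) cu1' c2 (p1 _ nDl) (p1 _ nDr)) u1E.
by rewrite (itvpi_parts du1' (dphi 0%N) cu2' c1 (p0 _ nDl) (p0 _ nDr)) opprK u2E.
Qed.

(** A twice continuously differentiable function is its own continuous representative, and its
    classical derivatives are weak ones. *)
Lemma opH_smooth (a : R) : u (- (pi / 2)) = u (pi / 2 * a) ->
  u (pi / 2 * a) = u (pi / 2) ->
  opH a (fun x => (u x)%:C) (fun x => (- u2 x)%:C).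
Proof.
move=> ul ur; have mD := measurable_itvpi.
split.
- split; first split.
  + exact/L2_real/continuous_square_integrable.
  + move=> [|[|[|//]]] // _.
      exists (fun x => (u1 x)%:C); last exact: weak_derivative1.
      exact/L2_real/continuous_square_integrable.
    exists (fun x => (u2 x)%:C); last exact: weak_derivative2.
    exact/L2_real/continuous_square_integrable.
  + exists (fun x => (u x)%:C); split; [exact: aeW| |by rewrite ul|by rewrite ur].
    split; first exact: continuous_subspaceT.
    by apply: continuous_subspaceT => x; exact: cst_continuous.
- apply/L2_real => //; apply: continuous_square_integrable => x.
  by apply: continuousN; exact: cu2.
- rewrite (_ : (fun x => - (- u2 x)%:C) = (fun x => (u2 x)%:C)).
    exact: weak_derivative2.
  by apply/funext => x; rewrite rmorphN opprK.
Qed.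

End weak_derivatives.

(** * Root functions of the operator *)

Section root_functions.
Context {R : realType} (a : R).
Local Notation D := (@itvpi R).
Local Notation mu := (@lebesgue_measure R).
Local Notation GE := (generalised_eigenfunctions itvpi (opH a)).
Implicit Types u w : R -> R.

(** Coefficients may be complex; only the resulting combination is real. This makes the real-valued
    monotone class argument applicable. *)
Definition real_span : set (R -> R) :=
  [set g : R -> R | lin_span GE (fun x => (g x)%:C)].

Lemma generalised_eigenfunctions_L2 : GE `<=` L2 D.
Proof.
move=> f [_ [l _ [[//|n] _ [h [g [dom _ _] _] _]]]].
by have [[]] := dom.
Qed.

Lemma real_spanD u w : real_span u -> real_span w ->
  real_span (fun x => u x + w x).
Proof.
rewrite /real_span /= => Su Sw; have := lin_spanD Su Sw; congr lin_span.
by apply/funext => x; rewrite rmorphD.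
Qed.

Lemma real_spanZ (k : R) u : real_span u -> real_span (fun x => k * u x).
Proof.
rewrite /real_span /= => Su; have := lin_spanZ k%:C Su; congr lin_span.
by apply/funext => x; rewrite rmorphM.
Qed.

Lemma real_span_square_integrable u : real_span u -> square_integrable D u.
Proof.
move=> Su; have /(L2P measurable_itvpi)[] // :=
  lin_span_L2 measurable_itvpi generalised_eigenfunctions_L2 Su.
Qed.

Local Notation W := (L2_closure D real_span).

Lemma root_class : closed_class D W.
Proof.
apply: L2_closure_closed; [exact: measurable_itvpi|exact: real_spanD|
  exact: real_spanZ|exact: real_span_square_integrable|exact: itvpi_lty].
Qed.

(** Root functions are non-zero by definition, so candidates that vanish almost everywhere are
    instead approximated by 0. *)
Lemma ae0_class u : measurable_fun D u -> L2_eq D (fun x => (u x)%:C) (cst 0) ->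
  W u.
Proof.
move=> mu_ u0; split => // e e0; exists (cst 0).
  rewrite /real_span /= (_ : (fun x => _) = cst 0); first exact: lin_span0.
  exact/funext.
rewrite /sqint (ae_eq_integral (cst 0%E)) ?integral0 ?lte_fin //.
- exact: measurable_itvpi.
- apply/measurable_EFinP; apply: measurable_funX.
  by under eq_fun do rewrite subr0.
- apply: (@filterS _ _ (ae_filter_ringOfSetsType mu) _ _ _ u0) => x h Dx.
  by have [->] := h Dx; rewrite subr0 expr0n.
Qed.

(** By continuity [u] is non-zero on a ball inside [D], and a ball has positive measure. *)
Lemma continuous_neq0 u x0 : continuous u -> D x0 -> u x0 != 0 ->
  ~ L2_eq D (fun x => (u x)%:C) (cst 0).
Proof.
move=> cu Dx0 ux0 u0.
have : \forall x \near x0, D x /\ u x != 0.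
  near=> x; split.
    near: x; apply: open_nbhs_nbhs; split => //; exact: interval_open.
  near: x; apply: (cu x0 [set y | y != 0]).
  by apply: open_nbhs_nbhs; split => //; exact: open_neq.
move=> /nbhs_ballP[d /= d0 dD].
have : mu.-negligible (ball x0 d).
  apply: negligibleS u0 => x /dD[Dx ux] /= /(_ Dx)[] /eqP.
  by rewrite (negbTE ux).
have mB : measurable (ball x0 d) by exact: measurable_ball.
move=> /(negligibleP mu mB) B0.
have [/eqP] := etrans (esym (lebesgue_measure_ball x0 (ltW d0))) B0.
by rewrite mulrn_eq0 /= gt_eqF.
Unshelve. all: by end_near. Qed.

Section smooth.
Variables (u u1 u2 : R -> R).
Hypothesis du : forall x : R, is_derive x 1 u (u1 x).
Hypothesis du1 : forall x : R, is_derive x 1 u1 (u2 x).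
Hypothesis cu2 : continuous u2.
Hypotheses (ul : u (- (pi / 2)) = u (pi / 2 * a))
  (ur : u (pi / 2 * a) = u (pi / 2)).

Lemma op_sub_smooth (l : R) w : (forall x, w x = - u2 x - l * u x) ->
  op_sub (opH a) l%:C (fun x => (u x)%:C) (fun x => (w x)%:C).
Proof.
move=> wE; exists (fun x => (- u2 x)%:C); first exact: (opH_smooth du du1).
by apply/funext => x; rewrite wE rmorphB rmorphM.
Qed.

Let mu_ : measurable_fun D u.
Proof.
apply: measurable_funTS; apply: continuous_measurable_fun.
apply: derivable_continuous => x.
exact: (@ex_derive _ _ _ _ _ _ _ (du x)).
Qed.

Lemma smooth_ker (l : R) : (forall x, u2 x = - (l * u x)) ->
  op_ker (op_sub (opH a) l%:C) (fun x => (u x)%:C).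
Proof.
move=> u2E; rewrite /op_ker /=.
rewrite (_ : cst 0 = fun x => ((0 : R)%:C)) //.
by apply: (op_sub_smooth (w := cst 0)) => x; rewrite u2E opprK subrr.
Qed.

Let op_pow0 T : op_pow D T 0 (cst 0) (cst 0).
Proof. by split; [exact: L2_0 measurable_itvpi..|exact: aeW]. Qed.

Lemma eigenfunction_class (l : R) : (forall x, u2 x = - (l * u x)) -> W u.
Proof.
move=> u2E; have ku := smooth_ker u2E.
have [u0|u0] := pselect (L2_eq D (fun x => (u x)%:C) (cst 0)).
  exact: ae0_class.
apply: L2_closure_id; first exact: real_span_square_integrable.
apply: lin_span_id; split => //; exists l%:C.
  by exists (fun x => (u x)%:C).
by exists 1%N => //; exists (cst 0); last exact: op_pow0.
Qed.

(** The operator minus [l] sends [u] to the eigenfunction [w], and [w] to 0, so the exponent is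
    2. *)
Lemma generalised_eigenfunction_class (l : R) w :
  (forall x, w x = - u2 x - l * u x) ->
  op_ker (op_sub (opH a) l%:C) (fun x => (w x)%:C) ->
  ~ L2_eq D (fun x => (w x)%:C) (cst 0) -> W u.
Proof.
move=> wE kw w0.
have [u0|u0] := pselect (L2_eq D (fun x => (u x)%:C) (cst 0)).
  exact: ae0_class.
apply: L2_closure_id; first exact: real_span_square_integrable.
apply: lin_span_id; split => //; exists l%:C.
  by exists (fun x => (w x)%:C).
exists 2%N => //; exists (fun x => (w x)%:C); first exact: op_sub_smooth.
by exists (cst 0); last exact: op_pow0.
Qed.

End smooth.

Lemma is_derive_scale (k x : R) : is_derive x 1 (fun y : R => k * y) k.
Proof. by apply: is_derive_eq; exact: mulr1. Qed.

(** For fixed [k] the family is stable under differentiation, so one derivative rule serves for both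
    orders. *)
Definition trig (k A B x : R) := A * cos (k * x) + B * sin (k * x).

Lemma is_derive_trig (k A B x : R) :
  is_derive x 1 (trig k A B) (trig k (B * k) (- (A * k)) x).
Proof.
have dc := is_derive1_comp (is_derive_cos (k * x)) (is_derive_scale k x).
have ds := is_derive1_comp (is_derive_sin (k * x)) (is_derive_scale k x).
have h := is_deriveD (is_deriveM (is_derive_cst A x 1) dc)
    (is_deriveM (is_derive_cst B x 1) ds).
apply: (is_derive_eq h).
by rewrite !scaler0 !addr0 /trig /GRing.scale /=; ring.
Qed.

Lemma continuous_trig (k A B : R) : continuous (trig k A B).
Proof.
apply: derivable_continuous => x.
exact: (@ex_derive _ _ _ _ _ _ _ (is_derive_trig k A B x)).
Qed.

Lemma is_derive_idM (f : R -> R) (x df : R) : is_derive x 1 f df ->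
  is_derive x 1 (fun y => y * f y) (x * df + f x).
Proof.
move=> dfx; have h := is_deriveM (is_derive_id x (1 : R)) dfx; apply: (is_derive_eq h).
by rewrite /GRing.scale /= mulr1.
Qed.

Lemma trig_class (k A B : R) :
  trig k A B (- (pi / 2)) = trig k A B (pi / 2 * a) ->
  trig k A B (pi / 2 * a) = trig k A B (pi / 2) -> W (trig k A B).
Proof.
move=> vl vr; apply: (eigenfunction_class (is_derive_trig k A B)
  (is_derive_trig k _ _) (@continuous_trig _ _ _) vl vr (l := k ^+ 2)) => x.
by rewrite /trig; ring.
Qed.

(** The operator minus [k^2] sends [x sin (k x)] to [-2 k cos (k x)]. The vanishing sines give the
    first function its boundary conditions, and the equality of cosines makes the second an
    eigenfunction. *)
Lemma id_sin_class (k : R) : k != 0 -> sin (k * (pi / 2)) = 0 ->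
  sin (k * (pi / 2 * a)) = 0 -> cos (k * (pi / 2)) = cos (k * (pi / 2 * a)) ->
  W (fun x => x * sin (k * x)).
Proof.
move=> k0 sk ska ck.
have -> : (fun x => x * sin (k * x)) = (fun x => x * trig k 0 1 x).
  by apply/funext => x; rewrite /trig mul0r add0r mul1r.
have d1 x := is_derive_idM (is_derive_trig k 0 1 x).
have d2 (x : R) := is_deriveD (is_derive_idM (is_derive_trig k (1 * k) (- (0 * k)) x))
  (is_derive_trig k 0 1 x).
have D0 : D 0 by rewrite /itvpi /= in_itv /= oppr_lt0 andbb divr_gt0 // pi_gt0.
pose w := trig k (- (2 * k)) 0.
apply: (generalised_eigenfunction_class d1 d2 _ _ _ (l := k ^+ 2) (w := w)).
- move=> x; apply: cvgD; last exact: continuous_trig.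
  apply: cvgD; last exact: continuous_trig.
  by apply: cvgM; [exact: cvg_id|exact: continuous_trig].
- by rewrite /trig mulrN sinN sk ska; ring.
- by rewrite /trig ska sk; ring.
- by move=> x; rewrite /w /trig; ring.
- apply: (smooth_ker (is_derive_trig _ _ _) (is_derive_trig _ _ _)
    (@continuous_trig _ _ _)).
  + by rewrite /trig mulrN cosN ck; ring.
  + by rewrite /trig ck; ring.
  + by move=> x; rewrite /trig; ring.
- apply: (continuous_neq0 (@continuous_trig _ _ _) D0).
  by rewrite /w /trig mulr0 cos0 mul0r addr0 mulr1 oppr_eq0 mulf_neq0.
Qed.

End root_functions.

(** * Boundary conditions in terms of [b] and [c], and the conclusion *)

Section main.
Context {R : realType} (a : R) (ha : -1 < a < 1).
Local Notation D := (@itvpi R).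
Local Notation W := (L2_closure D (real_span a)).

(** [s] is the interior point of the boundary condition; [b] and [c] solve [b + c = pi / 2] and
    [b - c = |s|]. *)
Let s := pi / 2 * a.
Let b := (pi / 2 + `|s|) / 2.
Let c := (pi / 2 - `|s|) / 2.

Let s_lt : `|s| < pi / 2.
Proof.
have p0 : 0 < pi / 2 :> R by rewrite divr_gt0 // pi_gt0.
by rewrite normrM gtr0_norm // gtr_pMr // ltr_norml.
Qed.

Let c0 : 0 < c. Proof. by rewrite divr_gt0 // subr_gt0. Qed.

Let cb : c <= b.
Proof. by rewrite ler_pM2r ?invr_gt0 // lerD2l ge0_cp // normr_ge0. Qed.

Let b0 : 0 < b := lt_le_trans c0 cb.

Let bDc : b + c = pi / 2.
Proof.
have h (x y : R) : (x + y) / 2 + (x - y) / 2 = x by field.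
exact: h.
Qed.

Let bBc : b - c = `|s|.
Proof.
have h (x y : R) : (x + y) / 2 - (x - y) / 2 = y by field.
exact: h.
Qed.

Let sin_natpi n : sin (n%:R * pi) = 0 :> R.
Proof. by rewrite -[n%:R * pi]add0r sinDpiM sin0 mulr0. Qed.

Let cosM_norm (k x : R) : cos (k * `|x|) = cos (k * x).
Proof.
have [x0|x0] := leP 0 x; first by rewrite ger0_norm.
by rewrite ltr0_norm // mulrN cosN.
Qed.

Let sinM_norm (k x : R) : sin (k * `|x|) = 0 -> sin (k * x) = 0.
Proof.
have [x0|x0] := leP 0 x; first by rewrite ger0_norm.
by rewrite ltr0_norm // mulrN sinN => /eqP; rewrite oppr_eq0 => /eqP.
Qed.

(* cos k(b + c) - cos k(b - c) = -2 sin(kb) sin(kc) *)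
Let cos_bnd (k : R) : sin (k * b) = 0 \/ sin (k * c) = 0 ->
  cos (k * (pi / 2)) = cos (k * s).
Proof.
rewrite -(cosM_norm k s) -bDc -bBc mulrDr mulrBr cosD cosB.
by case=> ->; rewrite ?mul0r ?mulr0 subr0 addr0.
Qed.

Let cos_class (k : R) : sin (k * b) = 0 \/ sin (k * c) = 0 ->
  W (fun x => cos (k * x)).
Proof.
move=> /cos_bnd ck; have : W (trig k 1 0).
  by apply: trig_class; rewrite /trig ?mulrN ?cosN !mul0r ck.
by congr W; apply/funext => x; rewrite /trig mul0r addr0 mul1r.
Qed.

Let sin_ratio n (d : R) : 0 < d -> sin (n%:R * (pi / d) * d) = 0.
Proof. by move=> d0; rewrite -mulrA divfK ?gt_eqF. Qed.

Let Wb n : W (fun x => cos (n%:R * (pi / b * x))).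
Proof.
under eq_fun do rewrite mulrA; apply: cos_class; left; exact: sin_ratio.
Qed.

Let Wc n : W (fun x => cos (n%:R * (pi / c * x))).
Proof.
under eq_fun do rewrite mulrA; apply: cos_class; right; exact: sin_ratio.
Qed.

(** If [sin (k b)] and [sin (k c)] vanish, so do the sines of [k (b + c)] and [k (b - c)]; hence
    [x sin (k x)] is 0 at all three boundary points. *)
Let Wx n : (0 < n)%N -> sin (n%:R * (pi / c * b)) = 0 ->
  W (fun x => x * sin (n%:R * (pi / c * x))).
Proof.
move=> n0; rewrite mulrA => sb; have sc := sin_ratio n c0.
under eq_fun do rewrite mulrA.
apply: id_sin_class.
- by rewrite mulf_neq0 ?pnatr_eq0 ?lt0n_neq0 // gt_eqF // divr_gt0 // pi_gt0.
- by rewrite -bDc mulrDr sinD sb sc mul0r mulr0 addr0.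
- by apply: sinM_norm; rewrite -bBc mulrBr sinB sb sc mul0r mulr0 subr0.
- by apply: cos_bnd; left.
Qed.

(** For [k = 2 (n + 1)] the sine vanishes at both ends, so the two end values agree for every [A];
    the interior point imposes one linear equation on [A]. *)
Let Wodd n : exists k : R,
  W (fun x => k * cos (n.+1%:R * (2 * x)) + sin (n.+1%:R * (2 * x))).
Proof.
pose k : R := n.+1%:R * 2.
have sk : sin (k * (pi / 2)) = 0.
  by rewrite /k -mulrA (mulrC 2) divfK ?pnatr_eq0 // sin_natpi.
suff [A hA] : exists A : R,
    A * cos (k * (pi / 2)) = A * cos (k * s) + sin (k * s).
  exists A; have : W (trig k A 1).
    by apply: trig_class; rewrite /trig ?mulrN ?cosN ?sinN !mul1r sk hA ?oppr0 addr0.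
  by congr W; apply/funext => x; rewrite /trig mul1r /k !mulrA.
(* When the coefficient of [A] is 0, [cos (k s)] is 1 or -1, hence [sin (k s) = 0] and [A = 0]
   solves the equation. *)
have [ck|ck] := eqVneq (cos (k * (pi / 2))) (cos (k * s)).
  exists 0; rewrite !mul0r add0r; apply/esym/cos1sin0.
  by rewrite -ck; exact: sin0cos1.
exists (sin (k * s) / (cos (k * (pi / 2)) - cos (k * s))).
by apply/eqP; rewrite -subr_eq0 opprD addrA -mulrBr divfK ?subrr // subr_eq0.
Qed.

Lemma real_completeness u : square_integrable D u -> W u.
Proof.
have cW := root_class a.
apply: L2_closure_bounded.
- exact: measurable_itvpi.
- exact: real_span_square_integrable.
- move=> f K; apply: (bounded_class cW) => // {}f {}K.
  exact: (even_class cW b0 c0 cb bDc).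
Qed.

End main.

Theorem theorem4 (R : realType) (a : R) (ha : (-1 < a < 1)%R) :
  dense_in_L2 itvpi (lin_span (generalised_eigenfunctions itvpi (opH a))).
Proof.
have mD := @measurable_itvpi R.
split; first exact: lin_span_L2 mD (@generalised_eigenfunctions_L2 R a).
move=> f /(L2P mD)[fr fi] e e0.
(* Squared errors below [e^2 / 2] in the real and imaginary parts add up to less than [e^2]. *)
have [mr /(_ (e ^+ 2 / 2))] := real_completeness ha fr.
have [mi /(_ (e ^+ 2 / 2))] := real_completeness ha fi.
have e2 : 0 < e ^+ 2 / 2 by rewrite divr_gt0 // exprn_gt0.
move=> /(_ e2)[v Sv fv] /(_ e2)[u Su fu].
exists (fun x => (u x)%:C + 'i * (v x)%:C).
  by apply: lin_spanD => //; exact: lin_spanZ.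
have [[mu_ _] [mv _]] := (real_span_square_integrable Su,
  real_span_square_integrable Sv).
have Er x : complex.Re (f x - ((u x)%:C + 'i * (v x)%:C)) =
    complex.Re (f x) - u x.
  by case: (f x) => p q /=; ring.
have Ei x : complex.Im (f x - ((u x)%:C + 'i * (v x)%:C)) =
    complex.Im (f x) - v x.
  by case: (f x) => p q /=; ring.
apply: (L2norm_lt mD e0).
- by under eq_fun do rewrite Er; exact: measurable_funB.
- by under eq_fun do rewrite Ei; exact: measurable_funB.
- by under eq_fun do rewrite Er.
- by under eq_fun do rewrite Ei.
Qed.
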